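(* For every closed formula $A$: (1) if $\ell\mathsf{Kt}2\vdash A$ then $\ell\mathsf{Kt}2\setminus\mathsf{cut}\vdash A$; (2) if $\ell\mathsf{IKt}2\vdash A$ then $\ell\mathsf{IKt}2\setminus\mathsf{cut}\vdash A$.
   Context: Formulas: over a set $\mathsf{Pr}$ of propositional symbols and a disjoint set of variables, $A ::= P \mid X \mid A\to B \mid \Box A \mid \blacksquare A \mid \forall X A$; closed formulas have no free variables; $A[C/X]$ is capture-avoiding substitution. Labelled sequents. Fix a set of world symbols $u,v,w,\dots$. A relational atom is $vRw$; a labelled formula is $v:A$ with $A$ a closed formula. A sequent is $\mathcal R\mid\Gamma\Rightarrow\Delta$ with $\mathcal R$ a set of relational atoms and $\Gamma,\Delta$ multisets of labelled formulas. The system $\ell\mathsf{Kt}2$ has the rules (a symbol is fresh if it does not occur in the conclusion): id: $\mathcal R\mid v:A\Rightarrow v:A$. cut: from $\mathcal R\mid\Gamma\Rightarrow\Delta,v:A$ and $\mathcal R\mid\Gamma',v:A\Rightarrow\Delta'$ infer $\mathcal R\mid\Gamma,\Gamma'\Rightarrow\Delta,\Delta'$. Weakening and contraction on both sides (adding a labelled formula; merging two copies of $v:A$ into one). $\to$L: from $\mathcal R\mid\Gamma\Rightarrow\Delta,v:A$ and $\mathcal R\mid\Gamma',v:B\Rightarrow\Delta'$ infer $\mathcal R\mid\Gamma,\Gamma',v:A\to B\Rightarrow\Delta,\Delta'$. $\to$R: from $\mathcal R\mid\Gamma,v:A\Rightarrow\Delta,v:B$ infer $\mathcal R\mid\Gamma\Rightarrow\Delta,v:A\to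 B$. $\forall$L: from $\mathcal R\mid\Gamma,v:A[C/X]\Rightarrow\Delta$ infer $\mathcal R\mid\Gamma,v:\forall XA\Rightarrow\Delta$ ($C$ any closed formula). $\forall$R: from $\mathcal R\mid\Gamma\Rightarrow\Delta,v:A[P/X]$ infer $\mathcal R\mid\Gamma\Rightarrow\Delta,v:\forall XA$, $P$ a fresh propositional symbol. $\Box$L: from $\mathcal R,vRw\mid\Gamma,w:A\Rightarrow\Delta$ infer $\mathcal R,vRw\mid\Gamma,v:\Box A\Rightarrow\Delta$. $\Box$R: from $\mathcal R,vRw\mid\Gamma\Rightarrow\Delta,w:A$ infer $\mathcal R\mid\Gamma\Rightarrow\Delta,v:\Box A$, $w$ fresh. $\blacksquare$L: from $\mathcal R,uRv\mid\Gamma,u:A\Rightarrow\Delta$ infer $\mathcal R,uRv\mid\Gamma,v:\blacksquare A\Rightarrow\Delta$. $\blacksquare$R: from $\mathcal R,uRv\mid\Gamma\Rightarrow\Delta,u:A$ infer $\mathcal R\mid\Gamma\Rightarrow\Delta,v:\blacksquare A$, $u$ fresh. $\ell\mathsf{IKt}2$ is the restriction of $\ell\mathsf{Kt}2$ to sequents whose right-hand side is a singleton (so no right weakening/contraction). $\mathsf L\setminus\mathsf{cut}$ denotes system $\mathsf L$ without the cut rule. For a closed formula $A$, $\mathsf L\vdash A$ means $\mathsf L$ proves $\emptyset\mid\emptyset\Rightarrow v:A$. *)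

(* Defs.v *)
From HB Require Import structures.
From mathcomp Require Import all_boot.
From mathcomp Require Import finmap multiset.

Set Implicit Arguments.
Unset Strict Implicit.
Unset Printing Implicit Defensive.

Local Open Scope fset_scope.
Local Open Scope mset_scope.

Definition infinite (T : choiceType) : Prop :=
  forall s : {fset T}, exists x, x \notin s.

Inductive form (Pr Var : Type) : Type :=
| Prp of Pr
| Vr of Var
| Imp of form Pr Var & form Pr Var
| Box of form Pr Var
| BBox of form Pr Var
| All of Var & form Pr Var.

Arguments Prp {Pr Var} _.
Arguments Vr {Pr Var} _.

Section FormEncoding.
Variables Pr Var : Type.

Fixpoint form_enc (A : form Pr Var) : GenTree.tree (Pr + Var) :=
  match A with
  | Prp P => GenTree.Leaf (inl P)
  | Vr X => GenTree.Leaf (inr X)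
  | Imp A B => GenTree.Node 0 [:: form_enc A; form_enc B]
  | Box A => GenTree.Node 1 [:: form_enc A]
  | BBox A => GenTree.Node 2 [:: form_enc A]
  | All X A => GenTree.Node 3 [:: GenTree.Leaf (inr X); form_enc A]
  end.

Fixpoint form_dec (t : GenTree.tree (Pr + Var)) : option (form Pr Var) :=
  match t with
  | GenTree.Leaf (inl P) => Some (Prp P)
  | GenTree.Leaf (inr X) => Some (Vr X)
  | GenTree.Node 0 [:: a; b] =>
      if (form_dec a, form_dec b) is (Some A, Some B) then Some (Imp A B)
      else None
  | GenTree.Node 1 [:: a] => omap (@Box Pr Var) (form_dec a)
  | GenTree.Node 2 [:: a] => omap (@BBox Pr Var) (form_dec a)
  | GenTree.Node 3 [:: GenTree.Leaf (inr X); a] =>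
      omap (All X) (form_dec a)
  | _ => None
  end.

Lemma form_encK : pcancel form_enc form_dec.
Proof.
by elim=> [P|X|A IHA B IHB|A IHA|A IHA|X A IHA] //=; rewrite ?IHA ?IHB.
Qed.

End FormEncoding.

HB.instance Definition _ (Pr Var : choiceType) :=
  Choice.copy (form Pr Var) (pcan_type (@form_encK Pr Var)).

Section Syntax.
Variables Pr Var : choiceType.

Fixpoint fv (A : form Pr Var) : {fset Var} :=
  match A with
  | Prp _ => fset0
  | Vr X => [fset X]
  | Imp A B => fv A `|` fv B
  | Box A | BBox A => fv A
  | All X A => fv A `\ X
  end%fset.

Definition closedf (A : form Pr Var) : bool := fv A == fset0.

Fixpoint psym (A : form Pr Var) : {fset Pr} :=
  match A with
  | Prp P => [fset P]
  | Vr _ => fset0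
  | Imp A B => psym A `|` psym B
  | Box A | BBox A | All _ A => psym A
  end%fset.

(* A[C/X].  Every rule below substitutes a closed C, so no variable of C can
   be captured and bound variables never need renaming. *)
Fixpoint subst (X : Var) (C : form Pr Var) (A : form Pr Var) : form Pr Var :=
  match A with
  | Prp P => Prp P
  | Vr Y => if Y == X then C else Vr Y
  | Imp A B => Imp (subst X C A) (subst X C B)
  | Box A => Box (subst X C A)
  | BBox A => BBox (subst X C A)
  | All Y A => if Y == X then All Y A else All Y (subst X C A)
  end.

End Syntax.

Section Sequents.
Variables Pr Var W : choiceType.

(* A pair (v, w) encodes the atom v R w, and (v, A) the formula v : A. *)
Definition relatoms := {fset W * W}.
Definition lforms := {mset W * form Pr Var}.

(* (R, G, D) stands for R | G => D.  Closedness of the labelled formulas is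
   the separate predicate is_sequent, imposed on every sequent of a
   derivation by the systems below. *)
Definition sequent : Type := (relatoms * lforms * lforms)%type.

Definition in_sequent (x : W * form Pr Var) (s : sequent) : Prop :=
  let: (_, G, D) := s in x \in G \/ x \in D.

Definition is_sequent (s : sequent) : Prop :=
  forall x, in_sequent x s -> closedf x.2.

Definition fresh_prop (P : Pr) (s : sequent) : Prop :=
  forall x, in_sequent x s -> P \notin psym x.2.

Definition fresh_world (w : W) (s : sequent) : Prop :=
  (forall a, a \in s.1.1 -> w <> a.1 /\ w <> a.2) /\
  (forall x, in_sequent x s -> w <> x.1).

Implicit Types (R : relatoms) (G D : lforms) (A B C : form Pr Var).
Implicit Types (X : Var) (P : Pr) (u v w : W).

(* A rule relates a list of premises to a conclusion. *)
Definition rules := seq sequent -> sequent -> Prop.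

Inductive noncut_rule : rules :=
| r_id R v A :
    noncut_rule [::] (R, [mset (v, A)], [mset (v, A)])
| r_wL R G D v A :
    noncut_rule [:: (R, G, D)] (R, (v, A) +` G, D)
| r_wR R G D v A :
    noncut_rule [:: (R, G, D)] (R, G, (v, A) +` D)
| r_cL R G D v A :
    noncut_rule [:: (R, (v, A) +` ((v, A) +` G), D)] (R, (v, A) +` G, D)
| r_cR R G D v A :
    noncut_rule [:: (R, G, (v, A) +` ((v, A) +` D))] (R, G, (v, A) +` D)
| r_impL R G G' D D' v A B :
    noncut_rule [:: (R, G, (v, A) +` D); (R, (v, B) +` G', D')]
                (R, (v, Imp A B) +` (G `+` G'), D `+` D')
| r_impR R G D v A B :
    noncut_rule [:: (R, (v, A) +` G, (v, B) +` D)]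
                (R, G, (v, Imp A B) +` D)
| r_allL R G D v X A C :
    closedf C ->
    noncut_rule [:: (R, (v, subst X C A) +` G, D)]
                (R, (v, All X A) +` G, D)
| r_allR R G D v X A P :
    fresh_prop P (R, G, (v, All X A) +` D) ->
    noncut_rule [:: (R, G, (v, subst X (Prp P) A) +` D)]
                (R, G, (v, All X A) +` D)
| r_boxL R G D v w A :
    noncut_rule [:: (((v, w) |` R)%fset, (w, A) +` G, D)]
                (((v, w) |` R)%fset, (v, Box A) +` G, D)
| r_boxR R G D v w A :
    fresh_world w (R, G, (v, Box A) +` D) ->
    noncut_rule [:: (((v, w) |` R)%fset, G, (w, A) +` D)]
                (R, G, (v, Box A) +` D)
| r_bboxL R G D u v A :
    noncut_rule [:: (((u, v) |` R)%fset, (u, A) +` G, D)]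
                (((u, v) |` R)%fset, (v, BBox A) +` G, D)
| r_bboxR R G D u v A :
    fresh_world u (R, G, (v, BBox A) +` D) ->
    noncut_rule [:: (((u, v) |` R)%fset, G, (u, A) +` D)]
                (R, G, (v, BBox A) +` D).

Inductive cut_rule : rules :=
| r_cut R G G' D D' v A :
    cut_rule [:: (R, G, (v, A) +` D); (R, (v, A) +` G', D')]
             (R, G `+` G', D `+` D').

Definition union_rules (L L' : rules) : rules :=
  fun ps c => L ps c \/ L' ps c.

Definition restrict (S : sequent -> Prop) (L : rules) : rules :=
  fun ps c => [/\ L ps c, forall p, p \in ps -> S p & S c].

Inductive derivable (L : rules) : sequent -> Prop :=
| der ps c : L ps c -> (forall p, p \in ps -> derivable L p) -> derivable L c.

Definition singleton_rhs (s : sequent) : Prop :=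
  exists x, s.2 = [mset x].

Definition lKt2_cutfree : rules := restrict is_sequent noncut_rule.
Definition lKt2 : rules :=
  restrict is_sequent (union_rules noncut_rule cut_rule).
Definition lIKt2_cutfree : rules := restrict singleton_rhs lKt2_cutfree.
Definition lIKt2 : rules := restrict singleton_rhs lKt2.

Definition proves (L : rules) (v : W) (A : form Pr Var) : Prop :=
  derivable L (fset0, mset0, [mset (v, A)]).

End Sequents.

Arguments lKt2_cutfree {Pr Var W}.
Arguments lKt2 {Pr Var W}.
Arguments lIKt2_cutfree {Pr Var W}.
Arguments lIKt2 {Pr Var W}.

(* Main.v *)
(* Both calculi are treated at once: the boolean i says whether right-hand sides
   are singletons. A Kripke-like model is built from the sequents themselves,
   ordered by inclusion of their supports. At a world v a formula denotes an
   upward closed set of sequents that is closed under biorthogonality with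
   respect to cut-free derivability, and quantifiers range over the pairs of a
   closed formula F and a family S of such sets lying, at each v, between the
   sequents with v : F in the antecedent and those that prove v : F without cut
   (candidates, as in Tait, Girard and Okada). Formulas denote candidates, and
   every rule, cut included, is sound for this semantics; evaluating the end
   sequent at itself yields a cut-free derivation. *)

Require Import Defs.
From mathcomp Require Import all_boot.
From mathcomp Require Import finmap multiset.

Set Implicit Arguments.
Unset Strict Implicit.
Unset Printing Implicit Defensive.

Local Open Scope mset_scope.

(** * Multiset preliminaries *)

Definition inE (K : choiceType) := (inE, @in_mset0 K, @in_mset1 K, @in_msetD K).

Lemma mset_ind (T : choiceType) (Q : {mset T} -> Prop) :
  Q mset0 -> (forall x A, Q A -> Q (x +` A)) -> forall A, Q A.
Proof.
move=> Q0 QS A; rewrite -(seq_mset_id A).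
elim: (A : seq T) => [|x s IHs]; last by rewrite mset_cons; apply: QS.
suff ->: seq_mset [::] = mset0 :> {mset T} by [].
by apply/msetP => x; rewrite mset_seqE mset0E.
Qed.

(** * Valid sequents and structural rules, for both calculi *)

Section CutElimination.
Variables (Pr Var W : choiceType).
Variable i : bool.

Notation form := (form Pr Var).
Notation sequent := (sequent Pr Var W).
Notation lform := (W * form)%type.
Notation relatoms := (relatoms W).
Notation lforms := (lforms Pr Var W).

Implicit Types (s c k : sequent) (R : relatoms) (G H D : lforms).
Implicit Types (A B C F : form) (v w u : W) (x y : lform).

Definition cut_free : rules Pr Var W := if i then lIKt2_cutfree else lKt2_cutfree.
Definition with_cut : rules Pr Var W := if i then lIKt2 else lKt2.
Local Notation "|- s" := (derivable cut_free s) (at level 85).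

Definition on_all (Q : lform -> Prop) G := forall x, x \in G -> Q x.

Lemma on_all0 Q : on_all Q mset0.
Proof. by move=> x; rewrite in_mset0. Qed.

Lemma on_allD Q G H : on_all Q (G `+` H) <-> on_all Q G /\ on_all Q H.
Proof.
split=> [QGH|[QG QH] x]; last by rewrite !inE => /orP[/QG|/QH].
by split=> x xG; apply: QGH; rewrite !inE xG ?orbT.
Qed.

Lemma on_all1 Q x G : on_all Q (x +` G) <-> Q x /\ on_all Q G.
Proof.
rewrite on_allD; split=> -[Qx QG]; split=> //; last by move=> y /[!inE]/eqP->.
by apply: Qx; rewrite !inE.
Qed.

Notation all_closed := (on_all (fun x => closedf x.2)).

Lemma is_sequentE s : is_sequent s <-> all_closed s.1.2 /\ all_closed s.2.
Proof.
case: s => [[R G] D]; split=> [cl|[clG clD] x []]; last exact: clD.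
- by split=> x xs; apply: cl; [left|right].
- exact: clG.
Qed.

(** The condition that [restrict] puts on the sequents of a derivation, uniform in [i]. *)
Definition valid s := is_sequent s /\ (i -> singleton_rhs s).

Lemma validE R G D : valid (R, G, D) <->
  [/\ all_closed G, all_closed D & i -> exists x, D = [mset x]].
Proof.
by split=> [[/is_sequentE[? ?] ?]|[? ? ?]]; split=> //; apply/is_sequentE.
Qed.

Lemma derivable_valid s : |- s -> valid s.
Proof. by rewrite /cut_free /valid; case: i; case=> ps c []; [case|]. Qed.

(** Derivable premises are already valid, so validity is checked at the conclusion alone. *)
Lemma derive ps s : noncut_rule ps s -> valid s ->
  (forall p, p \in ps -> |- p) -> |- s.
Proof.
move=> rs [vs ss] dps; apply: (der (ps := ps)) => //.
have vps p : p \in ps -> valid p by move=> /dps /derivable_valid.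
move: vps ss; rewrite /cut_free /valid; case: i => vps ss.
- split; last exact: ss.
  + by split=> // p /vps[].
  + by move=> p /vps[_]; apply.
- by split=> // p /vps[].
Qed.

Lemma derive1 p s : noncut_rule [:: p] s -> valid s -> |- p -> |- s.
Proof. by move=> r vs dp; apply: derive r vs _ => q; rewrite inE => /eqP->. Qed.

Lemma derive2 p q s : noncut_rule [:: p; q] s -> valid s -> |- p -> |- q -> |- s.
Proof.
by move=> r vs dp dq; apply: derive r vs _ => t; rewrite !inE => /orP[]/eqP->.
Qed.

Lemma weakenL R G H D : all_closed H -> |- (R, G, D) -> |- (R, H `+` G, D).
Proof.
move: H; elim/mset_ind => [|[v A] H IH]; first by rewrite mset0D.
rewrite -msetDA => /on_all1[clA clH] dG.
have dH := IH clH dG; apply: (derive1 (r_wL R _ _ v A) _ dH).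
by have /validE[? ? ?] := derivable_valid dH; apply/validE; split=> //; apply/on_all1.
Qed.

Lemma weakenR R G H D : ~~ i -> all_closed H -> |- (R, G, D) -> |- (R, G, H `+` D).
Proof.
move=> ni; move: H; elim/mset_ind => [|[v A] H IH]; first by rewrite mset0D.
rewrite -msetDA => /on_all1[clA clH] dG.
have dH := IH clH dG; apply: (derive1 (r_wR R _ _ v A) _ dH).
have /validE[? ? ?] := derivable_valid dH.
by apply/validE; split=> //; [apply/on_all1|rewrite (negbTE ni)].
Qed.

Lemma contractL R G H D : {subset H <= G} -> |- (R, H `+` G, D) -> |- (R, G, D).
Proof.
move: H; elim/mset_ind => [|[v A] H IH] sub; first by rewrite mset0D.
have xG : (v, A) \in G by apply: sub; rewrite !inE eqxx.
move=> dH; apply: IH => [y yH|]; first by apply: sub; rewrite !inE yH orbT.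
have /validE[/on_allD[/on_all1[clA clH] clG] clD siD] := derivable_valid dH.
(* A copy in [G] is exposed, to be merged with the one coming from [H]. *)
have eG : H `+` G = (v, A) +` (H `+` (G `\ (v, A))).
  by rewrite msetDCA msetB1K.
rewrite eG; apply: derive1 (r_cL R _ D v A) _ _; rewrite -eG.
  by apply/validE; split=> //; apply/on_allD.
by rewrite msetDA.
Qed.

Lemma contractR R G H D : ~~ i -> {subset H <= D} ->
  |- (R, G, H `+` D) -> |- (R, G, D).
Proof.
move=> ni; move: H; elim/mset_ind => [|[v A] H IH] sub; first by rewrite mset0D.
have xG : (v, A) \in D by apply: sub; rewrite !inE eqxx.
move=> dH; apply: IH => [y yH|]; first by apply: sub; rewrite !inE yH orbT.
have /validE[clG /on_allD[/on_all1[clA clH] clD] siD] := derivable_valid dH.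
have eD : H `+` D = (v, A) +` (H `+` (D `\ (v, A))).
  by rewrite msetDCA msetB1K.
rewrite eD; apply: derive1 (r_cR R _ _ v A) _ _; rewrite -eD.
  by apply/validE; split=> //; [apply/on_allD|rewrite (negbTE ni)].
by rewrite msetDA.
Qed.

(** Weaken by the larger side and contract the smaller one into it. When [i] holds both succedents
    are singletons, so their inclusion is an equality. Hence multiplicities do not matter and
    sequents can be compared by supports. *)
Lemma derivable_mono R G G' D D' :
  valid (R, G', D') -> {subset G <= G'} -> {subset D <= D'} ->
  |- (R, G, D) -> |- (R, G', D').
Proof.
move=> /validE[clG' clD' si'] subG subD dGD.
apply: (contractL subG); rewrite msetDC.
have dG : |- (R, G' `+` G, D) by apply: weakenL.
have [ii|ni] := boolP i; last first.
  apply: (contractR ni subD); rewrite [D `+` D']msetDC.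
  exact: weakenR.
have [[x eD'] /validE[_ _ /(_ ii)[y eD]]] := (si' ii, derivable_valid dG).
suff -> : D' = D by [].
have : y \in D' by apply: subD; rewrite eD !inE eqxx.
by rewrite eD' eD !inE => /eqP->.
Qed.

(** * Logical rules that keep their principal formula *)

(* The part of a succedent that a premise keeps besides its principal formula. *)
Definition side D : lforms := if i then mset0 else D.

Lemma validL R R' G D v A :
  valid (R, G, D) -> closedf A -> valid (R', (v, A) +` G, D).
Proof.
by move=> /validE[clG clD si] clA; apply/validE; split=> //; apply/on_all1.
Qed.

Lemma validR R R' G D v A :
  valid (R, G, D) -> closedf A -> valid (R', G, (v, A) +` side D).
Proof.
move=> /validE[clG clD si] clA; apply/validE; split=> //.
  by apply/on_all1; split=> //; rewrite /side; case: i => //; apply: on_all0.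
by rewrite /side => ->; exists (v, A); rewrite msetD0.
Qed.

Arguments validL {R R' G D v A}.
Arguments validR {R R' G D v A}.

Lemma side_sub D : {subset side D <= D}.
Proof. by rewrite /side; case: i => x; rewrite ?in_mset0. Qed.

(** The left rules below keep their principal formula: the original rule adds a second copy, which
    is contracted here. *)
Lemma absorbL R G D x : valid (R, G, D) -> x \in G ->
  |- (R, x +` G, D) -> |- (R, G, D).
Proof.
move=> vs xG; apply: derivable_mono => // y.
by rewrite !inE => /orP[/eqP->|].
Qed.

Lemma absorbR R G D x : valid (R, G, D) -> x \in D ->
  |- (R, G, x +` side D) -> |- (R, G, D).
Proof.
move=> vs xD; apply: derivable_mono => // y.
by rewrite !inE => /orP[/eqP->|/side_sub].
Qed.


Lemma cut_free_id R G D x : valid (R, G, D) -> x \in G -> x \in D ->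
  |- (R, G, D).
Proof.
case: x => v A vs xG xD; have /validE[/(_ _ xG) clA _ _] := vs.
have sub1 H : (v, A) \in H -> {subset [mset (v, A)] <= H}.
  by move=> xH y; rewrite !inE => /eqP->.
apply: derivable_mono vs (sub1 _ xG) (sub1 _ xD) _.
apply: derive (r_id R v A) _ _ => //; apply/validE; split; last by exists (v, A).
all: by move=> y; rewrite !inE => /eqP->.
Qed.

(** Both premises keep all of [G]. The first keeps only [side D], so that the sum of the two
    succedents is still a singleton when [i] holds. *)
Lemma cut_free_impL R G D v A B : valid (R, G, D) -> (v, Imp A B) \in G ->
  |- (R, G, (v, A) +` side D) -> |- (R, (v, B) +` G, D) -> |- (R, G, D).
Proof.
move=> vs xG dA dB; have /validE[clG clD si] := vs.
apply: (@derivable_mono _ ((v, Imp A B) +` (G `+` G)) _ (side D `+` D)) => //.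
- by move=> y; rewrite !inE orbb => /orP[/eqP->|].
- by move=> y; rewrite !inE => /orP[/side_sub|].
apply: derive2 (r_impL R G G _ D v A B) _ dA dB; apply/validE; split.
- by apply/on_all1; split; [exact: clG | apply/on_allD].
- by apply/on_allD; split=> // y /side_sub/clD.
- by move=> ii; rewrite /side ii mset0D; apply: si.
Qed.

Lemma cut_free_impR R G D v A B : valid (R, G, D) -> (v, Imp A B) \in D ->
  |- (R, (v, A) +` G, (v, B) +` side D) -> |- (R, G, D).
Proof.
move=> vs xD dp; apply: (absorbR vs xD); apply: derive1 (r_impR _ _ _ _ _ _) _ dp.
by apply: (validR vs _); have /validE[_ /(_ _ xD)] := vs.
Qed.

Lemma cut_free_allL R G D v X A C : valid (R, G, D) -> (v, All X A) \in G ->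
  closedf C -> |- (R, (v, subst X C A) +` G, D) -> |- (R, G, D).
Proof.
move=> vs xG clC dp; apply: (absorbL vs xG).
apply: derive1 (r_allL _ _ _ _ _ _ clC) _ dp.
by apply: (validL vs _); have /validE[/(_ _ xG)] := vs.
Qed.

Lemma cut_free_allR R G D v X A P : valid (R, G, D) -> (v, All X A) \in D ->
  fresh_prop P (R, G, D) ->
  |- (R, G, (v, subst X (Prp P) A) +` side D) -> |- (R, G, D).
Proof.
move=> vs xD frP dp; apply: (absorbR vs xD).
apply: derive1 (r_allR _) _ dp.
  move=> y [yG|]; first by apply: frP; left.
  by rewrite !inE => /orP[/eqP->|/side_sub yD]; apply: frP; right.
by apply: (validR vs _); have /validE[_ /(_ _ xD)] := vs.
Qed.

Lemma cut_free_boxL R G D v w A : valid (R, G, D) -> (v, Box A) \in G ->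
  (v, w) \in R -> |- (R, (w, A) +` G, D) -> |- (R, G, D).
Proof.
move=> vs xG vwR dp; apply: (absorbL vs xG); move: dp.
have <- : ((v, w) |` R)%fset = R by apply: mem_fset1U.
apply: derive1 (r_boxL _ _ _ _ _ _) _.
by apply: (validL vs _); have /validE[/(_ _ xG)] := vs.
Qed.

Lemma cut_free_bboxL R G D u v A : valid (R, G, D) -> (v, BBox A) \in G ->
  (u, v) \in R -> |- (R, (u, A) +` G, D) -> |- (R, G, D).
Proof.
move=> vs xG vwR dp; apply: (absorbL vs xG); move: dp.
have <- : ((u, v) |` R)%fset = R by apply: mem_fset1U.
apply: derive1 (r_bboxL _ _ _ _ _ _) _.
by apply: (validL vs _); have /validE[/(_ _ xG)] := vs.
Qed.

Lemma fresh_world_side w R G D x : fresh_world w (R, G, D) -> x \in D ->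
  fresh_world w (R, G, x +` side D).
Proof.
move=> [frR frG] xD; split=> // y [yG|]; first by apply: frG; left.
by rewrite !inE => /orP[/eqP->|/side_sub yD]; apply: frG; right.
Qed.

Lemma cut_free_boxR R G D v w A : valid (R, G, D) -> (v, Box A) \in D ->
  fresh_world w (R, G, D) ->
  |- (((v, w) |` R)%fset, G, (w, A) +` side D) -> |- (R, G, D).
Proof.
move=> vs xD frw dp; apply: (absorbR vs xD).
apply: derive1 (r_boxR (fresh_world_side frw xD)) _ dp.
by apply: (validR vs _); have /validE[_ /(_ _ xD)] := vs.
Qed.

Lemma cut_free_bboxR R G D u v A : valid (R, G, D) -> (v, BBox A) \in D ->
  fresh_world u (R, G, D) ->
  |- (((u, v) |` R)%fset, G, (u, A) +` side D) -> |- (R, G, D).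
Proof.
move=> vs xD frw dp; apply: (absorbR vs xD).
apply: derive1 (r_bboxR (fresh_world_side frw xD)) _ dp.
by apply: (validR vs _); have /validE[_ /(_ _ xD)] := vs.
Qed.

(** * Order, contexts and biorthogonality *)

Definition le s s' :=
  [/\ {subset s.1.1 <= s'.1.1}, {subset s.1.2 <= s'.1.2} & {subset s.2 <= s'.2}].

Lemma le_refl s : le s s. Proof. by split. Qed.

Lemma le_trans s1 s2 s3 : le s1 s2 -> le s2 s3 -> le s1 s3.
Proof.
move=> [R1 G1 D1] [R2 G2 D2]; split=> x.
- by move/R1/R2.
- by move/G1/G2.
- by move/D1/D2.
Qed.

Definition context c := is_sequent c /\ (i -> c.2 = mset0).

Definition ctx s : sequent := (s.1, side s.2).

Lemma ctx_context k : valid k -> context (ctx k).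
Proof.
move=> [/is_sequentE[clG clD] _]; split; last by rewrite /ctx /side /= => ->.
by apply/is_sequentE; split=> // x /side_sub/clD.
Qed.

Lemma ctx_le k : le (ctx k) k.
Proof. by split=> // x /side_sub. Qed.

Lemma le_ctx c k : context c -> le c k -> le c (ctx k).
Proof.
move=> [_ si] [leR leG leD]; split=> // x; rewrite /ctx /side /=.
by case: i si => [->|_ /leD] //; rewrite in_mset0.
Qed.


(** Right rules replace the succedent formula. A context below the conclusion stays below the
    premise because it contains no more of [D] than [side D]. *)
Lemma le_side c R R' G G' D D' : context c -> le c (R, G, D) ->
  {subset R <= R'} -> {subset G <= G'} -> {subset side D <= D'} ->
  le c (R', G', D').
Proof.
move=> cc /(le_ctx cc)[leR leG leD] RR' GG' DD'.
by split=> x; [move/leR/RR'|move/leG/GG'|move/leD/DD'].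
Qed.

(* The sequents k play the role of stacks and ctx k that of the context they
   contain, from which the intuitionistic succedent must be dropped. *)
Definition orth (S : sequent -> Prop) k :=
  forall k', valid k' -> le k k' -> S (ctx k') -> |- k'.

Lemma orth_mono S k k' : le k k' -> orth S k -> orth S k'.
Proof. by move=> kk' ok l vl k'l; apply: ok => //; apply: le_trans k'l. Qed.

(** Upward closure, and inclusion of the biorthogonal of [S] in [S]; on contexts the converse
    inclusion follows from upward closure. *)
Definition fact (S : sequent -> Prop) :=
  (forall c c', context c' -> le c c' -> S c -> S c') /\
  (forall c, context c ->
     (forall k, valid k -> le c k -> orth S k -> |- k) -> S c).

(** Testing all extensions makes this upward closed and meaningful for a context without
    succedent. *)
Definition prov F w c := forall k, valid k -> le c k -> (w, F) \in k.2 -> |- k.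

(** A stack with [w : F] on the right keeps it in every extension, hence is orthogonal to
    [prov F w]. *)
Lemma fact_prov F w : fact (prov F w).
Proof.
split=> [c c' _ cc' pc k vk /(le_trans cc')|c _ pc k vk ck Fk]; first exact: pc.
apply: pc => // k' vk' kk'; apply=> //; first exact: ctx_le.
by case: kk' => _ _; apply.
Qed.

(** * Candidates and the semantics of formulas *)

Definition sets := W -> sequent -> Prop.

Definition cand F (S : sets) :=
  [/\ closedf F, forall w, fact (S w),
      forall w c, context c -> (w, F) \in c.1.2 -> S w c
    & forall w c, context c -> S w c -> prov F w c].

Lemma cand_prov F : closedf F -> cand F (prov F).
Proof.
move=> clF; split=> // [w|w c _ Fc [[R G] D] vk [_ cG _]]; first exact: fact_prov.
by apply: cut_free_id => //; apply: cG.
Qed.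

(** Environments also interpret propositional symbols, because soundness of the right rule for [All]
    reinterprets its fresh symbol. *)
Definition key := (Pr + Var)%type.

Fixpoint sem (e : key -> sets) A : sets :=
  match A with
  | Prp P => e (inl P)
  | Vr X => e (inr X)
  | Imp A B => fun v c => forall c', context c' -> le c c' ->
      sem e A v c' -> sem e B v c'
  | Box A => fun v c => forall c' w, context c' -> le c c' ->
      (v, w) \in c'.1.1 -> sem e A w c'
  | BBox A => fun v c => forall c' u, context c' -> le c c' ->
      (u, v) \in c'.1.1 -> sem e A u c'
  | All X A => fun v c => forall F S, cand F S ->
      sem [eta e with inr X |-> S] A v c
  end.

(** For closure, a stack orthogonal to the value of an immediate subformula is orthogonal to the
    value of the compound: the context of any extension satisfying the compound also satisfies the
    subformula, by upward closure of the argument or of the relational atom. *)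
Lemma fact_sem e A w : (forall a w, fact (e a w)) -> fact (sem e A w).
Proof.
elim: A e w => [P|X|A IHA B IHB|A IHA|A IHA|X A IHA] e w fe //=.
- split=> [c c' _ cc' Sc d cd c'd|c cc Sc c' cc' le_cc' Ac'].
    exact: Sc (le_trans cc' c'd).
  apply: (IHB e w fe).2 => // k vk c'k ok; apply: Sc => //.
    exact: le_trans c'k.
  move=> k' vk' kk' Sk'; have c'k' := le_ctx cc' (le_trans c'k kk').
  apply: ok => //; apply: Sk' (ctx_context vk') (le_refl _) _.
  exact: (IHA e w fe).1 _ _ (ctx_context vk') c'k' Ac'.
- split=> [c c' _ cc' Sc d u cd c'd|c cc Sc c' u cc' le_cc' Rc'].
    exact: Sc (le_trans cc' c'd).
  apply: (IHA e u fe).2 => // k vk c'k ok; apply: Sc => //.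
    exact: le_trans c'k.
  move=> k' vk' kk' Sk'; have [Rk' _ _] := le_trans c'k kk'.
  by apply: ok => //; apply: Sk' (ctx_context vk') (le_refl _) _; apply: Rk'.
- split=> [c c' _ cc' Sc d u cd c'd|c cc Sc c' u cc' le_cc' Rc'].
    exact: Sc (le_trans cc' c'd).
  apply: (IHA e u fe).2 => // k vk c'k ok; apply: Sc => //.
    exact: le_trans c'k.
  move=> k' vk' kk' Sk'; have [Rk' _ _] := le_trans c'k kk'.
  by apply: ok => //; apply: Sk' (ctx_context vk') (le_refl _) _; apply: Rk'.
- have IH F S : cand F S -> fact (sem [eta e with inr X |-> S] A w).
    by case=> _ fS _ _; apply: IHA => a u /=; case: ifP.
  split=> [c c' cc' le_cc' Sc F S cFS|c cc Sc F S cFS].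
    exact: (IH F S cFS).1 _ _ cc' le_cc' (Sc F S cFS).
  apply: (IH F S cFS).2 => // k vk ck ok; apply: Sc => // k' vk' kk' Sk'.
  by apply: ok => //; apply: Sk' cFS.
Qed.

(** * Coincidence and substitution in the semantics *)

Definition occurs (a : key) A :=
  match a with inl P => P \in psym A | inr X => X \in fv A end.

Lemma eq_sem e e' A :
  (forall a, occurs a A -> forall w c, e a w c <-> e' a w c) ->
  forall w c, sem e A w c <-> sem e' A w c.
Proof.
elim: A e e' => [P|X|A IHA B IHB|A IHA|A IHA|X A IHA] e e' ee' w c /=.
- by apply: (ee' (inl P)); rewrite /= !inE.
- by apply: (ee' (inr X)); rewrite /= !inE.
- have eA : forall w c, sem e A w c <-> sem e' A w c.
    by apply: IHA => -[] a /= oa; apply: ee'; rewrite /= !inE oa.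
  have eB : forall w c, sem e B w c <-> sem e' B w c.
    by apply: IHB => -[] a /= oa; apply: ee'; rewrite /= !inE oa orbT.
  by split=> Sc c' cc' le_cc' /eA/Sc Bc'; apply/eB/Bc'.
- have eA := IHA e e' ee'.
  by split=> Sc c' u cc' le_cc' vu; apply/eA/Sc.
- have eA := IHA e e' ee'.
  by split=> Sc c' u cc' le_cc' vu; apply/eA/Sc.
- have eA S : forall w c, sem [eta e with inr X |-> S] A w c <->
                          sem [eta e' with inr X |-> S] A w c.
    apply: IHA => a oa {}w {}c /=; case: eqP => // /eqP nX; apply: ee'.
    by case: a oa nX => //= Y oY nX; rewrite !inE oY andbT.
  by split=> Sc F S /Sc Ac; apply/eA.
Qed.

Lemma sem_subst e X C A w c : closedf C ->
  sem e (subst X C A) w c <-> sem [eta e with inr X |-> sem e C] A w c.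
Proof.
move=> /eqP clC.
elim: A e w c => [P|Y|A IHA B IHB|A IHA|A IHA|Y A IHA] e w c //=.
- by case: (eqVneq Y X) => [->|nYX]; rewrite ?eqxx // (inj_eq inr_inj) (negbTE nYX).
- split=> Sc c' cc' le_cc' Ac'; apply/IHB; apply: Sc => //; exact/IHA.
- by split=> Sc c' u cc' le_cc' vu; apply/IHA/Sc.
- by split=> Sc c' u cc' le_cc' vu; apply/IHA/Sc.
have [->|nYX] /= := eqVneq Y X.
  have eA S : sem [eta e with inr X |-> S] A w c <->
      sem [eta [eta e with inr X |-> sem e C] with inr X |-> S] A w c.
    by apply: eq_sem => a _ u d /=; case: ifP.
  by split=> Sc F S /Sc/eA.
have eA S : sem [eta e with inr Y |-> S] (subst X C A) w c <->
    sem [eta [eta e with inr X |-> sem e C] with inr Y |-> S] A w c.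
  rewrite IHA; apply: eq_sem => a _ u d /=.
  case: (eqVneq a (inr X)) => [->|//]; rewrite (inj_eq inr_inj) eq_sym (negbTE nYX).
  (* As [C] is closed, rebinding [Y] does not change its value. *)
  apply: eq_sem => -[Q|Z] //=; by rewrite clC inE.
by split=> Sc F S /Sc Ac; apply/eA.
Qed.

(** * Simultaneous syntactic substitution *)

Fixpoint ssub (th : key -> form) A : form :=
  match A with
  | Prp P => th (inl P)
  | Vr X => th (inr X)
  | Imp A B => Imp (ssub th A) (ssub th B)
  | Box A => Box (ssub th A)
  | BBox A => BBox (ssub th A)
  | All X A => All X (ssub [eta th with inr X |-> Vr X] A)
  end.

Lemma eq_ssub th th' A : (forall a, th a = th' a) -> ssub th A = ssub th' A.
Proof.
elim: A th th' => [P|X|A IHA B IHB|A IHA|A IHA|X A IHA] th th' E /=;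
  rewrite ?(IHA _ _ E) ?(IHB _ _ E) //.
by congr All; apply: IHA => a /=; rewrite E.
Qed.

Lemma subst_notin X C A : X \notin fv A -> subst X C A = A.
Proof.
elim: A => [P|Y|A IHA B IHB|A IHA|A IHA|Y A IHA] //=; rewrite ?inE.
- by rewrite eq_sym => /negbTE->.
- by rewrite negb_or => /andP[/IHA-> /IHB->].
- by move/IHA->.
- by move/IHA->.
- by rewrite negb_and negbK eq_sym; case: eqP => //= _ /IHA->.
Qed.

(** The hypotheses describe [th] under a binder of [X]: [X] is fixed and no other image mentions it,
    so the later substitution acts only on occurrences of [X] from the original formula. *)
Lemma subst_ssub X C th A : th (inr X) = Vr X ->
  (forall a, a != inr X -> X \notin fv (th a)) ->
  subst X C (ssub th A) = ssub [eta th with inr X |-> C] A.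
Proof.
elim: A th => [P|Y|A IHA B IHB|A IHA|A IHA|Y A IHA] th thX thF /=.
- by rewrite subst_notin //; apply: thF.
- case: ifPn => [/eqP[->]|nYX]; first by rewrite thX /= eqxx.
  by rewrite subst_notin //; apply: thF.
- by rewrite IHA // IHB.
- by rewrite IHA.
- by rewrite IHA.
have [->|nYX] := eqVneq Y X.
  by congr All; apply: eq_ssub => a /=; case: ifP.
congr All; rewrite IHA /=.
- apply: eq_ssub => a /=; case: (eqVneq a (inr X)) => [->|//].
  by rewrite (inj_eq inr_inj) eq_sym (negbTE nYX).
- by rewrite (inj_eq inr_inj) eq_sym (negbTE nYX).
- by move=> a aX; case: ifP => _; [rewrite inE eq_sym|apply: thF].
Qed.

Lemma fv_ssub Z th A : (forall a, Z \notin fv (th a)) -> Z \notin fv (ssub th A).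
Proof.
elim: A th => [P|Y|A IHA B IHB|A IHA|A IHA|Y A IHA] th thZ //=.
- by rewrite inE negb_or IHA // IHB.
- exact: IHA.
- exact: IHA.
rewrite !inE; case: eqVneq => //= nZY.
by apply: IHA => a /=; case: ifP => _; rewrite ?inE.
Qed.

Definition atom (a : key) : form :=
  match a with inl P => Prp P | inr X => Vr X end.

Lemma ssub_atom th A : (forall a, occurs a A -> th a = atom a) -> ssub th A = A.
Proof.
elim: A th => [P|Y|A IHA B IHB|A IHA|A IHA|Y A IHA] th tha /=.
- by rewrite tha //= inE.
- by rewrite tha //= inE.
- rewrite IHA ?IHB // => -[] a /= oa; apply: tha => /=; rewrite inE oa ?orbT //.
- by rewrite IHA.
- by rewrite IHA.
congr All; apply: IHA => a oa /=; case: eqP => [->//|/eqP nY].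
by apply: tha; case: a oa nY => //= X oX nY; rewrite !inE oX andbT.
Qed.

Lemma closedfP A : reflect (forall Z, Z \notin fv A) (closedf A).
Proof.
apply: (iffP eqP) => [-> Z|clA]; first by rewrite inE.
by apply/fsetP => Z; rewrite inE (negbTE (clA Z)).
Qed.


(** * Fresh symbols *)

Lemma infinite_notin (T : choiceType) (xs : seq T) : infinite T ->
  exists t, t \notin xs.
Proof. by case/(_ [fset x in xs]%fset) => t; rewrite !inE; exists t. Qed.

Lemma exists_fresh_prop s : infinite Pr -> exists P, fresh_prop P s.
Proof.
case: s => [[R G] D] infPr.
have [P nP] := infinite_notin
  (flatten [seq enum_fset (psym x.2) | x <- enum_mset G ++ enum_mset D]) infPr.
exists P => x xGD; apply: contra nP => Px; apply/flatten_mapP; exists x => //.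
by rewrite mem_cat; case: xGD => [xG|xD]; apply/orP; [left|right].
Qed.

Lemma exists_fresh_world s : infinite W -> exists w, fresh_world w s.
Proof.
case: s => [[R G] D] infW.
have [w] := infinite_notin ([seq a.1 | a <- enum_fset R] ++
  [seq a.2 | a <- enum_fset R] ++ [seq x.1 | x <- enum_mset G ++ enum_mset D]) infW.
rewrite !mem_cat !negb_or => /and3P[n1 n2 n3]; exists w; split=> [a aR|x xGD].
  by split=> wa; [case/mapP: n1|case/mapP: n2]; exists a.
move=> wx; case/mapP: n3; exists x => //.
by rewrite mem_cat; case: xGD => [xG|xD]; apply/orP; [left|right].
Qed.

Hypotheses (infPr : infinite Pr) (infW : infinite W).

(** * Formulas denote candidates *)

Definition cands (th : key -> form) (e : key -> sets) :=
  forall a, cand (th a) (e a).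

Lemma cands_fact th e A w : cands th e -> fact (sem e A w).
Proof. by move=> the; apply: fact_sem => a u; case: (the a). Qed.

Lemma cands_upd th e a F S : cands th e -> cand F S ->
  cands [eta th with a |-> F] [eta e with a |-> S].
Proof. by move=> the cFS b /=; case: ifP. Qed.

Lemma subst_bound X F th e A : cands th e ->
  subst X F (ssub [eta th with inr X |-> Vr X] A) =
  ssub [eta th with inr X |-> F] A.
Proof.
move=> the; rewrite subst_ssub /= ?eqxx //.
  by apply: eq_ssub => a /=; case: (a == _).
move=> a /negbTE->; have [/closedfP clF _ _ _] := the a; exact: clF.
Qed.

Lemma closed_ssub th e A : cands th e -> closedf (ssub th A).
Proof.
move=> the; apply/closedfP => Z; apply: fv_ssub => a.
by have [/closedfP clF _ _ _] := the a; apply: clF.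
Qed.

Lemma mset1D_sub (T : choiceType) (x : T) (M : {mset T}) : {subset M <= x +` M}.
Proof. by move=> y yM; rewrite inE yM orbT. Qed.

(** Induction for all [th] and [e], since a quantifier extends both. The lower bound of a candidate
    comes from the left rule and biorthogonal closure, the upper bound from the right rule. *)
Lemma cand_sem th e A : cands th e -> cand (ssub th A) (sem e A).
Proof.
elim: A th e => [P|X|A IHA B IHB|A IHA|A IHA|X A IHA] th e the.
- exact: the (inl P).
- exact: the (inr X).
- have clAB := closed_ssub (Imp A B) the.
  have [clA _ inA outA] := IHA th e the; have [clB fB inB outB] := IHB th e the.
  split=> // [w|w c cc ABc c' cc' [_ lecc' _] Ac'|w c cc ABc [[R G] D] vk ck ABk].
  + exact: (cands_fact (Imp A B) w the).
  + apply: (fB w).2 => // -[[R G] D] vk c'k ok; have [_ Gk _] := c'k.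
    apply: (cut_free_impL vk (Gk _ (lecc' _ ABc))).
      apply: (outA _ _ cc' Ac'); first exact: validR vk clA.
        by apply: (le_side cc' c'k) => //; apply: mset1D_sub.
      exact: mset1D1.
    have vk' : valid (R, (w, ssub th B) +` G, D) by apply: validL vk clB.
    apply: ok => //; first by split=> //; apply: mset1D_sub.
    by apply: inB; [exact: ctx_context|apply: mset1D1].
  apply: (cut_free_impR vk ABk).
  (* In the premise of the right rule [A] is in the antecedent, so its context satisfies [A], hence
     [B], and the upper bound for [B] derives it. *)
  set k' := (X in |- X).
  have vk' : valid k' by apply: validR (validL vk clA) clB.
  have ck' : le c (ctx k').
    by apply: le_ctx => //; apply: (le_side cc ck) => //; apply: mset1D_sub.
  have ctxk' := ctx_context vk'.
  apply: (outB w _ ctxk' _ k') => //; last exact: mset1D1; last exact: ctx_le.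
  by apply: ABc => //; apply: inA => //; apply: mset1D1.
- have clA : closedf (ssub th A) := closed_ssub A the.
  have [_ fA inA outA] := IHA th e the.
  split=> // [w|v c cc Bc c' w cc' [_ lecc' _] vw|v c cc Bc [[R G] D] vk ck Bk].
  + exact: (cands_fact (Box A) w the).
  + apply: (fA w).2 => // -[[R G] D] vk c'k ok; have [Rk Gk _] := c'k.
    apply: (cut_free_boxL vk (Gk _ (lecc' _ Bc)) (Rk _ vw)).
    have vk' : valid (R, (w, ssub th A) +` G, D) by apply: validL vk clA.
    apply: ok => //; first by split=> //; apply: mset1D_sub.
    by apply: inA; [exact: ctx_context|apply: mset1D1].
  have [w frw] := exists_fresh_world (R, G, D) infW.
  apply: (cut_free_boxR vk Bk frw).
  set k' := (X in |- X).
  have vk' : valid k' by apply: validR vk clA.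
  have ck' : le c (ctx k').
    apply: le_ctx => //; apply: (le_side cc ck) => //; last exact: mset1D_sub.
    by move=> a aR; rewrite !inE aR orbT.
  have ctxk' := ctx_context vk'.
  apply: (outA w _ ctxk' _ k') => //; last exact: mset1D1; last exact: ctx_le.
  by apply: Bc => //; rewrite !inE eqxx.
- have clA : closedf (ssub th A) := closed_ssub A the.
  have [_ fA inA outA] := IHA th e the.
  split=> // [w|v c cc Bc c' w cc' [_ lecc' _] vw|v c cc Bc [[R G] D] vk ck Bk].
  + exact: (cands_fact (BBox A) w the).
  + apply: (fA w).2 => // -[[R G] D] vk c'k ok; have [Rk Gk _] := c'k.
    apply: (cut_free_bboxL vk (Gk _ (lecc' _ Bc)) (Rk _ vw)).
    have vk' : valid (R, (w, ssub th A) +` G, D) by apply: validL vk clA.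
    apply: ok => //; first by split=> //; apply: mset1D_sub.
    by apply: inA; [exact: ctx_context|apply: mset1D1].
  have [w frw] := exists_fresh_world (R, G, D) infW.
  apply: (cut_free_bboxR vk Bk frw).
  set k' := (X in |- X).
  have vk' : valid k' by apply: validR vk clA.
  have ck' : le c (ctx k').
    apply: le_ctx => //; apply: (le_side cc ck) => //; last exact: mset1D_sub.
    by move=> a aR; rewrite !inE aR orbT.
  have ctxk' := ctx_context vk'.
  apply: (outA w _ ctxk' _ k') => //; last exact: mset1D1; last exact: ctx_le.
  by apply: Bc => //; rewrite !inE eqxx.
have clA := closed_ssub (All X A) the.
split=> // [w|v c cc Ac F S cFS|v c cc Ac [[R G] D] vk ck Ak].
- exact: (cands_fact (All X A) w the).
- have [clF _ _ _] := cFS.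
  have [clAF fA inA _] := IHA _ _ (cands_upd (inr X) the cFS).
  apply: (fA v).2 => // -[[R G] D] vk ck ok; have [_ Gk _] := ck.
  apply: (cut_free_allL vk (Gk _ Ac) clF); rewrite (subst_bound _ _ _ the).
  have vk' : valid (R, (v, ssub [eta th with inr X |-> F] A) +` G, D).
    exact: validL vk clAF.
  apply: ok => //; first by split=> //; apply: mset1D_sub.
  by apply: inA; [exact: ctx_context|apply: mset1D1].
have [P frP] := exists_fresh_prop (R, G, D) infPr.
apply: (cut_free_allR vk Ak frP); rewrite (subst_bound _ _ _ the).
(* The semantic quantifier is instantiated at the fresh symbol itself, with its provers as
   candidate. *)
have cP : cand (Prp P) (prov (Prp P)) by apply: cand_prov; apply/eqP.
have [clAP _ _ outA] := IHA _ _ (cands_upd (inr X) the cP).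
apply: (outA v c cc (Ac _ _ cP)); first exact: validR vk clAP.
  by apply: (le_side cc ck) => //; apply: mset1D_sub.
exact: mset1D1.
Qed.

(** * Soundness of the calculi with cut *)

Lemma valid_rhs R G D x : valid (R, G, x +` D) -> i -> D = mset0.
Proof.
move=> /validE[_ _ si] /si[y eD].
have xy : x = y by apply/eqP; rewrite -in_mset1 -eD mset1D1.
by rewrite -(msetD1K x D) eD xy msetBxx.
Qed.

(** Biorthogonal closure with side formulas [D]. If [D] is nonempty then [i] is false and [ctx k] is
    [k], so orthogonality to [D] passes to all stacks above [c]. *)
Lemma fact_intro S (T : lform -> sequent -> Prop) D k c :
  fact S -> (i -> D = mset0) -> on_all (fun y => orth (T y) k) D ->
  context c -> le (ctx k) c ->
  (forall k', valid k' -> le c k' -> on_all (fun y => orth (T y) k') D ->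
     orth S k' -> |- k') ->
  S c.
Proof.
move=> [_ fS] iD oD cc kc prem; apply: fS => // k' vk' ck' ok'.
apply: prem => // y yD; have ni : i = false.
  by apply/negP => /iD D0; rewrite D0 inE in yD.
apply: orth_mono (oD y yD); have := le_trans kc ck'.
by rewrite /ctx /side ni -surjective_pairing.
Qed.

Definition relsat (sg : W -> W) R k :=
  forall a, a \in R -> (sg a.1, sg a.2) \in k.1.1.

Definition antsat e (sg : W -> W) G c := on_all (fun x => sem e x.2 (sg x.1) c) G.

Definition sucsat e (sg : W -> W) D k :=
  on_all (fun x => orth (sem e x.2 (sg x.1)) k) D.

Lemma relsat_mono sg R k k' : le k k' -> relsat sg R k -> relsat sg R k'.
Proof. by move=> [leR _ _] sR a /sR/leR. Qed.

Lemma antsat_mono th e sg G c c' : cands th e -> context c' -> le c c' ->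
  antsat e sg G c -> antsat e sg G c'.
Proof.
move=> the cc' lecc' sG x /sG.
by have [up _] := cands_fact x.2 (sg x.1) the; apply: up.
Qed.

Lemma orth_anti (S S' : sequent -> Prop) k :
  (forall c, S c -> S' c) -> orth S' k -> orth S k.
Proof. by move=> SS' ok k' vk' kk' /SS'; apply: ok. Qed.

(** The form in which freshness is used: reinterpreting a fresh symbol changes nothing in the
    conclusion. *)
Definition agree s e e' (sg sg' : W -> W) := forall x, in_sequent x s ->
  sg x.1 = sg' x.1 /\ forall a, occurs a x.2 -> forall w c, e a w c <-> e' a w c.

Lemma eq_antsat e e' sg sg' R G D c : agree (R, G, D) e e' sg sg' ->
  antsat e sg G c -> antsat e' sg' G c.
Proof.
move=> E sat x xG; have [<- ee'] := E x (or_introl xG).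
by apply/(eq_sem ee'); apply: sat.
Qed.

Lemma eq_sucsat e e' sg sg' R G D k : agree (R, G, D) e e' sg sg' ->
  sucsat e sg D k -> sucsat e' sg' D k.
Proof.
move=> E sat x xG; have [<- ee'] := E x (or_intror xG).
by apply: orth_anti (sat x xG) => c /(eq_sem ee').
Qed.

Lemma agree_sub R G D x e e' sg sg' : agree (R, G, x +` D) e e' sg sg' ->
  agree (R, G, D) e e' sg sg'.
Proof.
move=> E y [yG|yD]; apply: E; [by left|right].
exact: mset1D_sub.
Qed.

Definition sound s := forall th e sg k, cands th e -> valid k ->
  relsat sg s.1.1 k -> antsat e sg s.1.2 (ctx k) -> sucsat e sg s.2 k -> |- k.

Lemma with_cutE ps s : with_cut ps s ->
  [/\ noncut_rule ps s \/ cut_rule ps s, forall p, p \in ps -> valid p & valid s].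
Proof.
rewrite /with_cut /valid; case: i => -[].
- by case=> r vps vs sps ss; split=> // p pps; split; [apply: vps|move=> _; apply: sps].
- by move=> r vps vs; split=> // p /vps.
Qed.

Lemma ctx_ctx_mono k k' : valid k -> le (ctx k) k' -> le (ctx k) (ctx k').
Proof. by move=> vk; apply/le_ctx/ctx_context. Qed.

(** Cut and left implication need the succedent formula of one premise to hold at [ctx k], so as to
    feed the antecedent of the other. *)
Lemma sound_succedent R G D v A th e sg k : sound (R, G, (v, A) +` D) ->
  (i -> D = mset0) -> cands th e -> valid k ->
  relsat sg R k -> antsat e sg G (ctx k) -> sucsat e sg D k ->
  sem e A (sg v) (ctx k).
Proof.
move=> snd iD the vk sR sG sD.
apply: (fact_intro (cands_fact _ _ the) iD sD (ctx_context vk) (le_refl _)).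
move=> k' vk' kk' sDk' oA; have ck' := ctx_ctx_mono vk kk'.
apply: (snd _ _ _ _ the vk' _ _ _).
- exact: relsat_mono kk' sR.
- exact: antsat_mono the (ctx_context vk') ck' sG.
- exact/on_all1.
Qed.

(** Left rules unfold the principal formula at [ctx k]. Right rules use its orthogonality at [k]
    itself, which reduces the goal to its truth at [ctx k]; [fact_intro] then leads to the
    premise. *)
Lemma soundness s : derivable with_cut s -> sound s.
Proof.
elim=> {}ps {}s /with_cutE[r vps vs] _ IH th e sg k the vk.
case: r vps vs IH => [|[R G G' D D' v A]].
  case=> {ps s}.
  - move=> R v A _ _ _ _ sG sD.
    apply: (sD _ (mset11 _) k vk (le_refl k)); exact: sG (mset11 _).
  - move=> R G D v A _ _ /(_ _ (mem_head _ _)) IH sR /on_all1[_ sG] sD.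
    exact: IH the vk sR sG sD.
  - move=> R G D v A _ _ /(_ _ (mem_head _ _)) IH sR sG /on_all1[_ sD].
    exact: IH the vk sR sG sD.
  - move=> R G D v A _ _ /(_ _ (mem_head _ _)) IH sR /on_all1[sA sG] sD.
    by apply: (IH _ _ _ _ the vk sR _ sD); apply/on_all1; split=> //; apply/on_all1.
  - move=> R G D v A _ _ /(_ _ (mem_head _ _)) IH sR sG /on_all1[sA sD].
    by apply: (IH _ _ _ _ the vk sR sG _); apply/on_all1; split=> //; apply/on_all1.
  - move=> R G G' D D' v A B vps _ IH sR.
    move=> /on_all1[/= sAB /on_allD[sG sG']] /on_allD[sD sD'].
    have vp := vps _ (mem_head _ _).
    have IH1 := IH _ (mem_head _ _).
    have IH2 : sound (R, (v, B) +` G', D') by apply: IH; rewrite !inE eqxx orbT.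
    apply: (IH2 _ _ _ _ the vk sR _ sD'); apply/on_all1; split=> //=.
    apply: sAB (ctx_context vk) (le_refl _) _.
    exact: sound_succedent IH1 (valid_rhs vp) the vk sR sG sD.
  - move=> R G D v A B _ vs /(_ _ (mem_head _ _)) IH sR sG /on_all1[/= oAB sD].
    apply: (oAB _ vk (le_refl _)) => c cc kc Ac.
    apply: (fact_intro (cands_fact _ _ the) (valid_rhs vs) sD cc kc) => k' vk' ck' sD' oB.
    have ck'' := le_ctx cc ck'.
    apply: (IH _ _ _ _ the vk' _ _ _).
    + exact: relsat_mono (le_trans kc ck') sR.
    + apply: (antsat_mono the (ctx_context vk') ck'' _).
      by apply/on_all1; split=> //; apply: antsat_mono the cc kc sG.
    + exact/on_all1.
  - move=> R G D v X A C clC _ _ /(_ _ (mem_head _ _)) IH sR /on_all1[/= sA sG] sD.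
    apply: (IH _ _ _ _ the vk sR _ sD); apply/on_all1; split=> //=.
    by apply/sem_subst => //; apply: sA (cand_sem C the).
  - move=> R G D v X A P frP _ vs /(_ _ (mem_head _ _)) IH sR sG /on_all1[/= oA sD].
    apply: (oA _ vk (le_refl _)) => F S cFS.
    (* The fresh [P] is reinterpreted by the arbitrary candidate [S], so that [A[P/X]] takes the
       value of [A] with [X] sent to [S]. *)
    have the' := cands_upd (inl P) the cFS.
    pose e' : key -> sets := [eta e with inl P |-> S].
    have clP : closedf (Prp P : form) by apply/eqP.
    have E : agree (R, G, (v, All X A) +` D) e e' sg sg.
      move=> x /frP nP; split=> // a oa w c; rewrite /e' /=.
      by case: eqP => // ea; move: oa nP; rewrite ea /= => ->.
    have cX := cands_upd (inr X) the cFS.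
    have kc := ctx_context vk.
    apply: (fact_intro (cands_fact _ _ cX) (valid_rhs vs) sD kc (le_refl _)) => /= k' vk' kk' sD' oS.
    have ck' := ctx_ctx_mono vk kk'.
    apply: (IH _ _ _ _ the' vk' _ _ _).
    + exact: relsat_mono kk' sR.
    + apply: (eq_antsat E); exact: antsat_mono the (ctx_context vk') ck' sG.
    + apply/on_all1; split; last exact: eq_sucsat (agree_sub E) sD'.
      apply: orth_anti oS => c /(@sem_subst e' X (Prp P) A _ c clP).1.
      suff eA w d : sem [eta e' with inr X |-> sem e' (Prp P)] A w d <->
          sem [eta e with inr X |-> S] A w d by move/eA.
      apply: eq_sem => a oa {}w {}d /=; case: (eqVneq a (inr X)) => [_|_].
        by rewrite /e' /= eqxx.
      case: (eqVneq a (inl P)) => aP; last by rewrite /e' /= (negbTE aP).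
      have := frP (v, All X A).
      by move: oa; rewrite aP /= => -> /(_ (or_intror (mset1D1 _ _))).
  - move=> R G D v w A vps _ /(_ _ (mem_head _ _)) IH sR /on_all1[/= sA sG] sD.
    apply: (IH _ _ _ _ the vk sR _ sD); apply/on_all1; split=> //=.
    apply: sA (ctx_context vk) (le_refl _) _.
    by apply: (sR (v, w)); rewrite !inE eqxx.
  - move=> R G D v w A frw _ vs /(_ _ (mem_head _ _)) IH sR sG /on_all1[/= oB sD].
    apply: (oB _ vk (le_refl _)) => c w' cc kc vw'.
    apply: (fact_intro (cands_fact _ _ the) (valid_rhs vs) sD cc kc) => k' vk' ck' sD' oA.
    have ck'' := le_ctx cc ck'.
    (* The fresh [w] is sent to the arbitrary successor [w']. *)
    pose sg' := [eta sg with w |-> w'].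
    have E : agree (R, G, (v, Box A) +` D) e e sg sg'.
      by move=> x /frw.2; rewrite /sg' /= eq_sym => /eqP/negbTE->.
    have /eqP nwv : w <> v by apply: (frw.2 (v, Box A)); right; apply: mset1D1.
    apply: (IH _ _ sg' _ the vk' _ _ _).
    + move=> a; rewrite /sg' /= !inE => /orP[/eqP->|aR] /=.
        rewrite eqxx eq_sym (negbTE nwv); case: ck' => leR _ _; exact: leR.
      have [/eqP n1 /eqP n2] := frw.1 a aR.
      rewrite ![_ == w]eq_sym (negbTE n1) (negbTE n2).
      exact: (relsat_mono (le_trans kc ck') sR).
    + apply: (eq_antsat E); apply: (antsat_mono the (ctx_context vk') ck'' _).
      exact: antsat_mono the cc kc sG.
    + apply/on_all1; split; last exact: eq_sucsat (agree_sub E) sD'.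
      by rewrite /sg' /= eqxx.
  - move=> R G D u v A vps _ /(_ _ (mem_head _ _)) IH sR /on_all1[/= sA sG] sD.
    apply: (IH _ _ _ _ the vk sR _ sD); apply/on_all1; split=> //=.
    apply: sA (ctx_context vk) (le_refl _) _.
    by apply: (sR (u, v)); rewrite !inE eqxx.
  - move=> R G D u v A frw _ vs /(_ _ (mem_head _ _)) IH sR sG /on_all1[/= oB sD].
    apply: (oB _ vk (le_refl _)) => c u' cc kc vw'.
    apply: (fact_intro (cands_fact _ _ the) (valid_rhs vs) sD cc kc) => k' vk' ck' sD' oA.
    have ck'' := le_ctx cc ck'.
    pose sg' := [eta sg with u |-> u'].
    have E : agree (R, G, (v, BBox A) +` D) e e sg sg'.
      by move=> x /frw.2; rewrite /sg' /= eq_sym => /eqP/negbTE->.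
    have /eqP nwv : u <> v by apply: (frw.2 (v, BBox A)); right; apply: mset1D1.
    apply: (IH _ _ sg' _ the vk' _ _ _).
    + move=> a; rewrite /sg' /= !inE => /orP[/eqP->|aR] /=.
        rewrite eqxx eq_sym (negbTE nwv); case: ck' => leR _ _; exact: leR.
      have [/eqP n1 /eqP n2] := frw.1 a aR.
      rewrite ![_ == u]eq_sym (negbTE n1) (negbTE n2).
      exact: (relsat_mono (le_trans kc ck') sR).
    + apply: (eq_antsat E); apply: (antsat_mono the (ctx_context vk') ck'' _).
      exact: antsat_mono the cc kc sG.
    + apply/on_all1; split; last exact: eq_sucsat (agree_sub E) sD'.
      by rewrite /sg' /= eqxx.
move=> vps _ IH sR /on_allD[sG sG'] /on_allD[sD sD'].
have vp := vps _ (mem_head _ _).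
have IH1 := IH _ (mem_head _ _).
have IH2 : sound (R, (v, A) +` G', D') by apply: IH; rewrite !inE eqxx orbT.
apply: (IH2 _ _ _ _ the vk sR _ sD'); apply/on_all1; split=> //=.
exact: sound_succedent IH1 (valid_rhs vp) the vk sR sG sD.
Qed.

(** * Cut elimination *)

Theorem cut_elimination v A : proves with_cut v A -> proves cut_free v A.
Proof.
(* Some symbol of [Pr] is needed to send variables to a closed formula; any will do, as [A] is
   closed. *)
move=> dA; have [P _] := infPr fset0.
pose th (a : key) : form := if a is inl Q then Prp Q else Prp P.
have the : cands th (fun a => prov (th a)).
  by move=> a; apply: cand_prov; case: a.
have vA : valid (fset0, mset0, [mset (v, A)]) by case: dA => ps s /with_cutE[].
have /validE[_ /(_ _ (mset11 _)) /= clA _] := vA.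
(* The end sequent is evaluated at itself. What remains is its orthogonality to the value of [A],
   which is the upper bound of the candidate. *)
apply: (soundness dA the (sg := id) vA) => [a|x|x /=]; rewrite ?inE //.
move=> /eqP-> k vk [_ _ vk'] sk; have [_ _ _ out] := cand_sem A the.
apply: (out v _ (ctx_context vk) sk k vk (ctx_le k)).
rewrite ssub_atom; first by apply: vk'; apply: mset11.
by case=> //= X; rewrite (eqP clA) inE.
Qed.

End CutElimination.

Theorem theoremC (Pr Var W : choiceType) (infPr : infinite Pr)
    (infW : infinite W)
    (v : W) (A : form Pr Var) (closedA : closedf A) :
  (proves lKt2 v A -> proves lKt2_cutfree v A) /\
  (proves lIKt2 v A -> proves lIKt2_cutfree v A).
Proof.
by split; [exact: (@cut_elimination _ _ _ false)|exact: (@cut_elimination _ _ _ true)].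
Qed.
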